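(* Let $n\ge1$ and $m\ge 0$ be integers. If $m\ge\left\lfloor\frac n2\right\rfloor$, or if $n=3$ and $m\ge1$, then $\pi_1(\mathbb{Z}_n,c_m)=\{1\}$.
   Context: A Čech closure space $(X,c)$ is a set $X$ with a map $c:\mathcal{P}(X)\to\mathcal{P}(X)$ such that $c(\emptyset)=\emptyset$, $A\subseteq c(A)$, and $c(A\cup B)=c(A)\cup c(B)$ (not assumed $c^2=c$). A topological space is a closure space via its topological closure. A map $f:(X,c_X)\to(Y,c_Y)$ is continuous iff $f(c_X(A))\subseteq c_Y(f(A))$ for all $A\subseteq X$. $U$ is a neighborhood of $x$ if $x\in X\setminus c(X\setminus U)$. The product closure structure on $X\times Y$ is the one in which, at each point $(x,y)$, the sets $V\times W$ ($V$ a neighborhood of $x$, $W$ a neighborhood of $y$) form a local base of neighborhoods. $(\mathbb{Z}_n,c_m)$ is the set $\mathbb{Z}_n=\mathbb{Z}/n\mathbb{Z}$ with $c_m([k])=\{[k-m],\dots,[k],\dots,[k+m]\}$ and $c_m(A)=\bigcup_{[k]\in A}c_m([k])$. $I=[0,1]$ has its usual topology. $\pi_1(X,* )$ is the group of homotopy classes rel $\partial I$ of continuous loops $v:I\to(X,c)$ based at $*$ (homotopies are continuous maps $I\times I\to (X,c)$ fixed on $\partial I$), with product given by concatenation; the basepoint is suppressed from the notation. *)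

(* Defs.v *)
From HB Require Import structures.
From mathcomp Require Import all_boot all_order all_algebra generic_quotient.
From mathcomp Require Import ring lra.
From mathcomp Require Import all_classical all_reals all_analysis.
Set Implicit Arguments.
Unset Strict Implicit.
Unset Printing Implicit Defensive.
Import Order.TTheory GRing.Theory Num.Theory numFieldNormedType.Exports.
Local Open Scope classical_set_scope.
Local Open Scope ring_scope.
Local Open Scope quotient_scope.

Record closureSpace := ClosureSpace {
  carrier :> Type;
  cl : set carrier -> set carrier;
  cl0 : cl set0 = set0;
  sub_cl : forall A, A `<=` cl A;
  clU : forall A B, cl (A `|` B) = cl A `|` cl B
}.

Definition ccontinuous (X Y : closureSpace) (f : X -> Y) :=
  forall A : set X, f @` cl A `<=` cl (f @` A).

Definition neighborhood (X : closureSpace) (x : X) (U : set X) :=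
  (~` cl (~` U)) x.

Section ClosureTheory.
Implicit Types X Y Z : closureSpace.

Lemma clS X (A B : set X) : A `<=` B -> cl A `<=` cl B.
Proof. by move=> /setUidPr <-; rewrite clU; left. Qed.

Lemma neighborhoodS X (x : X) (U V : set X) :
  U `<=` V -> neighborhood x U -> neighborhood x V.
Proof. by move=> UV xU /(clS (subsetC UV)). Qed.

Lemma neighborhoodI X (x : X) (U V : set X) :
  neighborhood x U -> neighborhood x V -> neighborhood x (U `&` V).
Proof. by move=> xU xV; rewrite /neighborhood setCI clU => -[]. Qed.

Lemma neighborhoodT X (x : X) : neighborhood x setT.
Proof. by rewrite /neighborhood setCT cl0. Qed.

Lemma clP X (A : set X) (x : X) :
  cl A x <-> forall U, neighborhood x U -> U `&` A !=set0.
Proof.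
split=> [Ax U xU|H].
  apply: contrapT => /set0P/negP/negPn/eqP UA0; apply: xU.
  by move: Ax; apply: clS => a Aa /= Ua; have : (U `&` A) a by []; rewrite UA0.
apply: contrapT => nAx; have [|y []//] := H (~` A).
by rewrite /neighborhood setCK.
Qed.

Lemma ccontinuousP X Y (f : X -> Y) :
  ccontinuous f <->
  forall x V, neighborhood (f x) V -> neighborhood x (f @^-1` V).
Proof.
split=> [cf x V fxV xV|H A _ [x Ax <-]].
  apply: fxV; have : (f @` cl (~` (f @^-1` V))) (f x) by exists x.
  by move=> /cf; apply: clS => _ [y yV <-].
apply/clP => V /H /((clP _ _).1 Ax) [y [Vy Ay]].
by exists (f y); split=> //; exists y.
Qed.

Lemma ccontinuous_comp X Y Z (f : X -> Y) (g : Y -> Z) :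
  ccontinuous f -> ccontinuous g -> ccontinuous (g \o f).
Proof.
move=> /ccontinuousP cf /ccontinuousP cg; apply/ccontinuousP => x V.
by move=> /cg/cf.
Qed.

Lemma ccontinuous_cst X Y (y : Y) : ccontinuous (fun _ : X => y).
Proof.
apply/ccontinuousP => x V yV.
have Vy : V y by apply: contrapT => nVy; apply: yV; exact: sub_cl.
by apply: neighborhoodS (@neighborhoodT _ x) => z _.
Qed.

Lemma ccontinuous_paste X Y (A B : set X) (f g h : X -> Y) :
  cl A `<=` A -> cl B `<=` B -> A `|` B = setT ->
  ccontinuous g -> ccontinuous h -> {in A, f =1 g} -> {in B, f =1 h} ->
  ccontinuous f.
Proof.
move=> cA cB AB cg ch fg fh S _ [x Sx <-].
have : cl (S `&` A `|` S `&` B) x by rewrite -setIUr AB setIT.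
have aux C k : cl C `<=` C -> ccontinuous k -> {in C, f =1 k} ->
    cl (S `&` C) x -> cl (f @` S) (f x).
  move=> cC ck fk xC; have Cx : C x by apply/cC/(clS _ xC) => ? [].
  rewrite fk ?inE//; have : (k @` cl (S `&` C)) (k x) by exists x.
  move=> /ck; apply: clS => _ [y [Sy Cy] <-].
  by exists y => //; rewrite fk ?inE.
by rewrite clU => -[]; [apply: aux cg _ | apply: aux ch _].
Qed.

Lemma cl_preimage X Y (f : X -> Y) (C : set Y) :
  ccontinuous f -> cl C `<=` C -> cl (f @^-1` C) `<=` f @^-1` C.
Proof.
move=> cf cC x xC; apply: cC.
have : (f @` cl (f @^-1` C)) (f x) by exists x.
by move=> /cf; apply: clS => _ [y ? <-].
Qed.

End ClosureTheory.
Arguments neighborhoodT {X} x.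

Definition top_closure (T : topologicalType) : closureSpace :=
  @ClosureSpace T closure (closure0 T) (@subset_closure T) (@closureU T).

Section ProductClosure.
Variables X Y : closureSpace.

(* The closure operator determined by the local base of the sets V `*` W:
   a point is close to A when every basic neighborhood of it meets A. *)
Definition prod_cl (A : set (X * Y)) : set (X * Y) :=
  [set p | forall V W, neighborhood p.1 V -> neighborhood p.2 W ->
           (V `*` W) `&` A !=set0].

Lemma prod_cl0 : prod_cl set0 = set0.
Proof.
apply/seteqP; split=> // p.
move=> /(_ _ _ (neighborhoodT p.1) (neighborhoodT p.2)).
by rewrite setI0 => -[].
Qed.

Lemma sub_prod_cl A : A `<=` prod_cl A.
Proof.
move=> p Ap V W pV pW; exists p; split=> //; split.
  by apply: contrapT => nVp; apply: pV; exact: sub_cl.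
by apply: contrapT => nWp; apply: pW; exact: sub_cl.
Qed.

Lemma prod_clU A B : prod_cl (A `|` B) = prod_cl A `|` prod_cl B.
Proof.
apply/seteqP; split=> [p pAB|p [] H V W pV pW]; last 2 first.
- by have [q [? ?]] := H V W pV pW; exists q; split=> //; left.
- by have [q [? ?]] := H V W pV pW; exists q; split=> //; right.
apply: contrapT => /not_orP[] /existsNP[V /existsNP[W]].
move=> /not_implyP[pV /not_implyP[pW VWA]].
move=> /existsNP[V' /existsNP[W' /not_implyP[pV' /not_implyP[pW' VWB]]]].
have [q [[[Vq V'q] [Wq W'q]] [Aq|Bq]]] :=
  pAB _ _ (neighborhoodI pV pV') (neighborhoodI pW pW').
- by apply: VWA; exists q.
- by apply: VWB; exists q.
Qed.

Definition prod_closure : closureSpace :=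
  @ClosureSpace (X * Y)%type prod_cl prod_cl0 sub_prod_cl prod_clU.

Lemma prod_neighborhoodP (p : prod_closure) (U : set prod_closure) :
  neighborhood p U <->
  exists V W, [/\ neighborhood p.1 V, neighborhood p.2 W & V `*` W `<=` U].
Proof.
split=> [/existsNP[V /existsNP[W /not_implyP[pV /not_implyP[pW VW]]]]|].
  exists V, W; split=> // q VWq; apply: contrapT => nUq.
  by apply: VW; exists q.
by move=> [V [W [pV pW VWU]]] /(_ V W pV pW)[q [/VWU]].
Qed.

Lemma ccontinuous_fst : @ccontinuous prod_closure X fst.
Proof.
apply/ccontinuousP => p V pV; apply/prod_neighborhoodP.
by exists V, setT; split=> //; [exact: neighborhoodT | move=> ? []].
Qed.

Lemma ccontinuous_snd : @ccontinuous prod_closure Y snd.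
Proof.
apply/ccontinuousP => p V pV; apply/prod_neighborhoodP.
by exists setT, V; split=> //; [exact: neighborhoodT | move=> ? []].
Qed.

Lemma ccontinuous_pair (Z : closureSpace) (f : Z -> X) (g : Z -> Y) :
  ccontinuous f -> ccontinuous g ->
  @ccontinuous Z prod_closure (fun z => (f z, g z)).
Proof.
move=> /ccontinuousP cf /ccontinuousP cg; apply/ccontinuousP => z U.
move=> /prod_neighborhoodP[V [W [/cf fV /cg gW VWU]]].
by apply: neighborhoodS (neighborhoodI fV gW) => y Vy; exact: VWU.
Qed.

End ProductClosure.

Lemma top_neighborhoodP (T : topologicalType) (x : top_closure T) U :
  neighborhood x U <-> nbhs (x : T) U.
Proof.
rewrite /neighborhood (_ : ~` _ = (U : set T)°) //.
by rewrite -[LHS]/(~` closure (~` U)) -interiorC setCK.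
Qed.

Lemma ccontinuous_top (T U : topologicalType) (f : T -> U) :
  continuous f -> @ccontinuous (top_closure T) (top_closure U) f.
Proof.
move=> cf; apply/ccontinuousP => x V /top_neighborhoodP fV.
by apply/top_neighborhoodP; exact: cf.
Qed.

Lemma ccontinuous_top2 (T U V : topologicalType) (f : T * U -> V) :
  continuous f ->
  @ccontinuous (prod_closure (top_closure T) (top_closure U)) (top_closure V) f.
Proof.
move=> cf; apply/ccontinuousP => x W /top_neighborhoodP /cf fW.
case: fW => -[A B] /= [xA xB] AB; apply/prod_neighborhoodP; exists A, B.
by split=> //; exact/top_neighborhoodP.
Qed.

Section UnitInterval.
Variable R : realType.

Definition unit_itv : topologicalType :=
  set_type (`[0 : R, 1 : R]%classic : set R).

Definition unitI : closureSpace := top_closure unit_itv.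
Definition unitI2 : closureSpace := prod_closure unitI unitI.

Definition ival (s : unitI) : R := sval s.

Lemma clamp_subproof (r : R) :
  Num.max 0 (Num.min r 1) \in (`[0 : R, 1 : R]%classic : set R).
Proof.
by rewrite inE /= in_itv /= le_max lexx /= ge_max ler01 ge_min lexx orbT.
Qed.

(* The retraction of the real line onto the unit interval. *)
Definition clamp (r : R) : unitI :=
  exist (fun r => r \in (`[0 : R, 1 : R]%classic : set R)) _ (clamp_subproof r).

Lemma ival_itv (s : unitI) : 0 <= ival s <= 1.
Proof. by case: s => r /=; rewrite inE /= in_itv. Qed.

Lemma ivalK s : clamp (ival s) = s.
Proof.
apply: eq_sig_hprop => [? ? ?|/=]; first exact: Prop_irrelevance.
have /andP[s0 s1] := ival_itv s.
by rewrite -/(ival s) (min_idPl s1) (max_idPr s0).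
Qed.

Lemma clampK r : 0 <= r <= 1 -> ival (clamp r) = r.
Proof. by move=> /andP[r0 r1]; rewrite /ival/= (min_idPl r1) (max_idPr r0). Qed.

Lemma clamp_continuous : continuous (clamp : R -> unit_itv).
Proof.
apply: continuous_comp_initial => r.
apply: (@continuous_max R R (cst 0) (fun r => Num.min r 1) r).
  exact: cvg_cst.
by apply: (@continuous_min R R id (cst 1)); [exact: cvg_id|exact: cvg_cst].
Qed.

Lemma ival_continuous : continuous (ival : unit_itv -> R).
Proof. exact: initial_continuous. Qed.

Definition I0 : unitI := clamp 0.
Definition I1 : unitI := clamp 1.

Lemma ival0 : ival I0 = 0.
Proof. by rewrite clampK// lexx ler01. Qed.

Lemma ival1 : ival I1 = 1.
Proof. by rewrite clampK// lexx ler01. Qed.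

Lemma ccont_clamp (a : R -> R) : continuous a ->
  @ccontinuous unitI unitI (fun s => clamp (a (ival s))).
Proof.
move=> ca; apply: ccontinuous_top => s.
apply: (@continuous_comp unit_itv R unit_itv (fun s => a (ival s)) clamp).
  apply: (@continuous_comp unit_itv R R ival a); first exact: ival_continuous.
  exact: ca.
exact: clamp_continuous.
Qed.

Lemma ccont_clamp2 (a : R -> R -> R) :
  continuous (fun p : R * R => a p.1 p.2) ->
  @ccontinuous unitI2 unitI (fun p => clamp (a (ival p.1) (ival p.2))).
Proof.
move=> ca; apply: (@ccontinuous_top2 unit_itv unit_itv unit_itv) => p.
apply: (@continuous_comp (unit_itv * unit_itv)%type R unit_itv
  (fun p => a (ival p.1) (ival p.2)) clamp); last exact: clamp_continuous.
apply: (@continuous_comp (unit_itv * unit_itv)%type (R * R)%type R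
  (fun p => (ival p.1, ival p.2)) (fun q => a q.1 q.2)); last exact: ca.
have c1 : (fun q : unit_itv * unit_itv => ival q.1) @ p --> ival p.1.
  apply: (@continuous_comp (unit_itv * unit_itv)%type unit_itv R fst ival).
    exact: cvg_fst.
  exact: ival_continuous.
have c2 : (fun q : unit_itv * unit_itv => ival q.2) @ p --> ival p.2.
  apply: (@continuous_comp (unit_itv * unit_itv)%type unit_itv R snd ival).
    exact: cvg_snd.
  exact: ival_continuous.
exact: (cvg_pair c1 c2).
Qed.

Lemma cl_ge (a : R) : cl [set s : unitI | a <= ival s] `<=` [set s | a <= ival s].
Proof.
apply: (@cl_preimage unitI (top_closure R) ival [set r | a <= r]).
  exact: (ccontinuous_top ival_continuous).
exact: closed_ge.
Qed.

Lemma cl_le (a : R) : cl [set s : unitI | ival s <= a] `<=` [set s | ival s <= a].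
Proof.
apply: (@cl_preimage unitI (top_closure R) ival [set r | r <= a]).
  exact: (ccontinuous_top ival_continuous).
exact: closed_le.
Qed.

(* Pasting at the parameter value 1/2 of a coordinate k. *)
Lemma ccont_glue (Z Y : closureSpace) (k : Z -> unitI) (g h : Z -> Y) :
  ccontinuous k -> ccontinuous g -> ccontinuous h ->
  (forall z, ival (k z) = 2^-1 -> g z = h z) ->
  ccontinuous (fun z => if ival (k z) <= 2^-1 then g z else h z).
Proof.
move=> ck cg ch gh.
apply: (@ccontinuous_paste Z Y [set z | ival (k z) <= 2^-1]
  [set z | 2^-1 <= ival (k z)] _ g h) => //.
- exact: (cl_preimage ck (@cl_le _)).
- exact: (cl_preimage ck (@cl_ge _)).
- by apply/seteqP; split=> // z _; apply/orP; exact: le_total.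
- by move=> z; rewrite inE /= => ->.
- move=> z; rewrite inE /= => kz; case: ifPn => // kz'.
  by apply: gh; apply/eqP; rewrite eq_le kz kz'.
Qed.

End UnitInterval.
Arguments ival {R} s : simpl never.
Arguments clamp {R} r : simpl never.

Section FundamentalGroup.
Variables (R : realType) (X : closureSpace) (x : X).

Record loop := Loop {
  loop_fun :> unitI R -> X;
  loop_continuous : ccontinuous loop_fun;
  loop0 : loop_fun (I0 R) = x;
  loop1 : loop_fun (I1 R) = x
}.
Arguments loop_continuous : clear implicits.

Definition homotopic (v w : loop) : Prop :=
  exists H : unitI2 R -> X,
    [/\ ccontinuous H,
        forall s, H (s, I0 R) = v s,
        forall s, H (s, I1 R) = w s &
        forall t, H (I0 R, t) = x /\ H (I1 R, t) = x].

Lemma homotopic_refl v : homotopic v v.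
Proof.
exists (fun p => v p.1); split=> //; last by move=> t /=; rewrite loop0 loop1.
apply: (@ccontinuous_comp (unitI2 R) (unitI R) X fst v).
  exact: ccontinuous_fst.
exact: loop_continuous.
Qed.

Lemma continuous_affine (a b : R) : continuous (fun r : R => a * r + b).
Proof.
move=> r; apply: cvgD; last exact: cvg_cst.
by apply: cvgM; [exact: cvg_cst|exact: cvg_id].
Qed.

Lemma homotopic_sym v w : homotopic v w -> homotopic w v.
Proof.
move=> [H [cH H0 H1 Hb]].
exists (fun p => H (p.1, clamp (- 1 * ival p.2 + 1))); split.
- apply: (ccontinuous_comp (f := fun p : unitI2 R =>
    ((p.1, clamp (- 1 * ival p.2 + 1)) : unitI2 R))) cH.
  apply: ccontinuous_pair; first exact: ccontinuous_fst.
  exact: (ccontinuous_comp (@ccontinuous_snd _ _)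
    (ccont_clamp (@continuous_affine _ _))).
- by move=> s; rewrite /= ival0 mulr0 add0r H1.
- by move=> s; rewrite /= ival1 mulr1 addNr H0.
- by move=> t; exact: Hb.
Qed.

Lemma homotopic_trans v u w : homotopic u v -> homotopic v w -> homotopic u w.
Proof.
move=> [H [cH H0 H1 Hb]] [K [cK K0 K1 Kb]].
exists (fun p => if ival p.2 <= 2^-1 then H (p.1, clamp (2 * ival p.2 + 0))
                 else K (p.1, clamp (2 * ival p.2 + -1))); split.
- have c a b L : @ccontinuous (unitI2 R) X L ->
      @ccontinuous (unitI2 R) X (fun p => L (p.1, clamp (a * ival p.2 + b))).
    apply: (ccontinuous_comp (f := fun p : unitI2 R =>
      ((p.1, clamp (a * ival p.2 + b)) : unitI2 R))).
    apply: ccontinuous_pair; first exact: ccontinuous_fst.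
    exact: (ccontinuous_comp (@ccontinuous_snd _ _)
      (ccont_clamp (@continuous_affine _ _))).
  apply: (@ccont_glue R (unitI2 R) X snd); [exact: ccontinuous_snd|exact: c|exact: c|].
  move=> [s t] /= ->; rewrite addr0 mulfV ?pnatr_eq0// subrr.
  by rewrite -/(I1 R) -/(I0 R) H1 K0.
- by move=> s; rewrite /= ival0 invr_ge0 ler0n mulr0 addr0 H0.
- move=> s; rewrite /= ival1 ifF; last by apply/negbTE; lra.
  by rewrite mulr1 (_ : 2 + -1 = 1 :> R) ?K1//; lra.
- move=> t /=; case: ifP => _; [exact: Hb|exact: Kb].
Qed.

Definition cst_loop : loop := @Loop (fun=> x) (@ccontinuous_cst _ _ x) erefl erefl.

Definition concat_fun (v w : loop) (s : unitI R) : X :=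
  if ival s <= 2^-1 then v (clamp (2 * ival s + 0))
  else w (clamp (2 * ival s + -1)).

Lemma concat_continuous v w : ccontinuous (concat_fun v w).
Proof.
apply: (@ccont_glue R (unitI R) X id) => //.
- by apply/ccontinuousP.
- exact: (ccontinuous_comp (ccont_clamp (@continuous_affine _ _))
    (loop_continuous v)).
- exact: (ccontinuous_comp (ccont_clamp (@continuous_affine _ _))
    (loop_continuous w)).
- move=> s ->; rewrite addr0 mulfV ?pnatr_eq0// subrr.
  by rewrite -/(I1 R) -/(I0 R) loop0 loop1.
Qed.

Lemma concat0 v w : concat_fun v w (I0 R) = x.
Proof. by rewrite /concat_fun ival0 invr_ge0 ler0n mulr0 addr0 loop0. Qed.

Lemma concat1 v w : concat_fun v w (I1 R) = x.
Proof.
rewrite /concat_fun ival1 ifF; last by apply/negbTE; lra.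
by rewrite mulr1 (_ : 2 + -1 = 1 :> R) ?loop1//; lra.
Qed.

Definition concat v w : loop :=
  Loop (@concat_continuous v w) (concat0 v w) (concat1 v w).

Definition rev_fun (v : loop) (s : unitI R) : X := v (clamp (- 1 * ival s + 1)).

Lemma rev_continuous v : ccontinuous (rev_fun v).
Proof.
exact: (ccontinuous_comp (ccont_clamp (@continuous_affine _ _))
  (loop_continuous v)).
Qed.

Lemma rev0 v : rev_fun v (I0 R) = x.
Proof. by rewrite /rev_fun ival0 mulr0 add0r loop1. Qed.

Lemma rev1 v : rev_fun v (I1 R) = x.
Proof. by rewrite /rev_fun ival1 mulr1 addNr loop0. Qed.

Definition rev_loop v : loop := Loop (@rev_continuous v) (rev0 v) (rev1 v).

Lemma homotopic_concat v v' w w' :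
  homotopic v v' -> homotopic w w' -> homotopic (concat v w) (concat v' w').
Proof.
move=> [H [cH H0 H1 Hb]] [K [cK K0 K1 Kb]].
exists (fun p => if ival p.1 <= 2^-1 then H (clamp (2 * ival p.1 + 0), p.2)
                 else K (clamp (2 * ival p.1 + -1), p.2)); split.
- have c a b L : @ccontinuous (unitI2 R) X L ->
      @ccontinuous (unitI2 R) X (fun p => L (clamp (a * ival p.1 + b), p.2)).
    apply: (ccontinuous_comp (f := fun p : unitI2 R =>
      ((clamp (a * ival p.1 + b), p.2) : unitI2 R))).
    apply: ccontinuous_pair; last exact: ccontinuous_snd.
    exact: (ccontinuous_comp (@ccontinuous_fst _ _)
      (ccont_clamp (@continuous_affine _ _))).
  apply: (@ccont_glue R (unitI2 R) X fst); [exact: ccontinuous_fst|exact: c|exact: c|].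
  move=> [s t] /= ->; rewrite addr0 mulfV ?pnatr_eq0// subrr.
  by rewrite -/(I1 R) -/(I0 R) (Hb t).2 (Kb t).1.
- by move=> s; rewrite /= /concat_fun H0 K0.
- by move=> s; rewrite /= /concat_fun H1 K1.
- move=> t /=; rewrite ival0 ival1 invr_ge0 ler0n mulr0 addr0 (Hb t).1.
  rewrite ifF; last by apply/negbTE; lra.
  by rewrite mulr1 (_ : 2 + -1 = 1 :> R) ?(Kb t).2//; lra.
Qed.

Lemma homotopic_rev v w :
  homotopic v w -> homotopic (rev_loop v) (rev_loop w).
Proof.
move=> [H [cH H0 H1 Hb]].
exists (fun p => H (clamp (- 1 * ival p.1 + 1), p.2)); split.
- apply: (ccontinuous_comp (f := fun p : unitI2 R =>
    ((clamp (- 1 * ival p.1 + 1), p.2) : unitI2 R))) cH.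
  apply: ccontinuous_pair; last exact: ccontinuous_snd.
  exact: (ccontinuous_comp (@ccontinuous_fst _ _)
    (ccont_clamp (@continuous_affine _ _))).
- by move=> s; rewrite /= H0.
- by move=> s; rewrite /= H1.
- by move=> t; rewrite /= ival0 ival1 mulr0 mulr1 add0r addNr; case: (Hb t).
Qed.

Lemma homotopic_reparam (v u w : loop) (a b : R -> R) :
  continuous a -> continuous b -> a 0 = b 0 -> a 1 = b 1 ->
  (forall s, u s = v (clamp (a (ival s)))) ->
  (forall s, w s = v (clamp (b (ival s)))) ->
  homotopic u w.
Proof.
move=> ca cb ab0 ab1 ua wb.
exists (fun p => v (clamp (a (ival p.1) + ival p.2 * (b (ival p.1) - a (ival p.1))))).
split.
- apply: (ccontinuous_comp (f := fun p : unitI2 R => clamp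
    (a (ival p.1) + ival p.2 * (b (ival p.1) - a (ival p.1)))))
    (loop_continuous v).
  apply: (@ccont_clamp2 R (fun r t => a r + t * (b r - a r))) => p.
  have c1 f : continuous f -> {for p, continuous (fun q : R * R => f q.1 : R)}.
    move=> cf; apply: (@continuous_comp _ _ _ fst f); last exact: cf.
    exact: cvg_fst.
  apply: cvgD; first exact: c1.
  apply: cvgM; first exact: cvg_snd.
  by apply: cvgB; exact: c1.
- by move=> s; rewrite /= ival0 mul0r addr0 ua.
- by move=> s; rewrite /= ival1 mul1r subrKC wb.
- move=> t /=; rewrite ival0 ival1 ab0 ab1 !subrr !mulr0 !addr0.
  by rewrite -{1}ab0 -{1}ab1 -[in LHS](ival0) -ua loop0 -ival1 -ua loop1.
Qed.

Lemma concat_le v w s : ival s <= 2^-1 -> concat v w s = v (clamp (2 * ival s)).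
Proof. by move=> s2; rewrite /= /concat_fun s2 addr0. Qed.

Lemma concat_gt v w s :
  2^-1 < ival s -> concat v w s = w (clamp (2 * ival s - 1)).
Proof. by move=> s2; rewrite /= /concat_fun leNgt s2. Qed.

Lemma concat_assoc u v w :
  homotopic (concat u (concat v w)) (concat (concat u v) w).
Proof.
pose b r : R := Num.min (Num.min (2 * r + 0) (1 * r + 4^-1)) (2^-1 * r + 2^-1).
apply: (@homotopic_reparam (concat u (concat v w)) _ _ id b).
- by move=> r; exact: cvg_id.
- move=> r; apply: (@continuous_min R R
    (fun r => Num.min (2 * r + 0) (1 * r + 4^-1)) (fun r => 2^-1 * r + 2^-1));
    last exact: continuous_affine.
  by apply: (@continuous_min R R (fun r => 2 * r + 0) (fun r => 1 * r + 4^-1));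
    exact: continuous_affine.
- by rewrite /= /b; case: (leP (2 * _ + 0)) => ?; case: leP => ?; lra.
- by rewrite /= /b; case: (leP (2 * _ + 0)) => ?; case: leP => ?; lra.
- by move=> s; rewrite ivalK.
move=> s; have /andP[s0 s1] := ival_itv s.
have [s4|s4] := leP (ival s) 4^-1.
  have -> : b (ival s) = 2 * ival s.
    by rewrite /b; case: (leP (2 * _ + 0)) => ?; case: leP => ?; lra.
  rewrite concat_le; last lra.
  rewrite !concat_le ?clampK//; lra.
have [s2|s2] := leP (ival s) 2^-1.
  have -> : b (ival s) = ival s + 4^-1.
    by rewrite /b; case: (leP (2 * _ + 0)) => ?; case: leP => ?; lra.
  rewrite concat_le// [LHS]concat_gt ?clampK; [|lra..].
  rewrite [RHS]concat_gt ?clampK; [|lra..].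
  rewrite concat_le ?clampK; [|lra..].
  by congr (v (clamp _)); lra.
have -> : b (ival s) = 2^-1 * ival s + 2^-1.
  by rewrite /b; case: (leP (2 * _ + 0)) => ?; case: leP => ?; lra.
rewrite concat_gt// [RHS]concat_gt ?clampK; [|lra..].
rewrite concat_gt ?clampK; [|lra..].
by congr (w (clamp _)); lra.
Qed.

Lemma concat_cst_l v : homotopic (concat cst_loop v) v.
Proof.
apply: (@homotopic_reparam v _ _ (fun r => Num.max 0 (2 * r + -1)) id).
- move=> r; apply: (@continuous_max R R (cst 0) (fun r => 2 * r + -1)); first exact: cvg_cst.
  exact: continuous_affine.
- by move=> r; exact: cvg_id.
- by rewrite /Num.max; case: ifP => ?; lra.
- by rewrite /Num.max; case: ifP => ?; lra.
- move=> s; have [s2|s2] := leP (ival s) 2^-1.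
    rewrite concat_le// (_ : Num.max _ _ = 0) ?loop0//.
    by rewrite /Num.max; case: ifP => ?; lra.
  rewrite concat_gt// (_ : Num.max _ _ = 2 * ival s - 1)//.
  by rewrite /Num.max; case: ifP => ?; lra.
- by move=> s; rewrite ivalK.
Qed.

Lemma concat_cst_r v : homotopic (concat v cst_loop) v.
Proof.
apply: (@homotopic_reparam v _ _ (fun r => Num.min 1 (2 * r + 0)) id).
- move=> r; apply: (@continuous_min R R (cst 1) (fun r => 2 * r + 0)); first exact: cvg_cst.
  exact: continuous_affine.
- by move=> r; exact: cvg_id.
- by rewrite /Num.min; case: ifP => ?; lra.
- by rewrite /Num.min; case: ifP => ?; lra.
- move=> s; have [s2|s2] := leP (ival s) 2^-1.
    rewrite concat_le// (_ : Num.min _ _ = 2 * ival s)//.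
    by rewrite /Num.min; case: ifP => ?; lra.
  rewrite concat_gt// (_ : Num.min _ _ = 1) ?loop1//.
  by rewrite /Num.min; case: ifP => ?; lra.
- by move=> s; rewrite ivalK.
Qed.

Lemma concat_rev_r v : homotopic (concat v (rev_loop v)) cst_loop.
Proof.
apply: (@homotopic_reparam v _ _
  (fun r => Num.min (2 * r + 0) (- 2 * r + 2)) (cst 0)).
- by move=> r; apply: (@continuous_min R R (fun r => 2 * r + 0)
    (fun r => - 2 * r + 2)); exact: continuous_affine.
- by move=> r; exact: cvg_cst.
- by rewrite /= /Num.min; case: ifP => ?; lra.
- by rewrite /= /Num.min; case: ifP => ?; lra.
- move=> s; have /andP[s0 s1] := ival_itv s.
  have [s2|s2] := leP (ival s) 2^-1.
    rewrite concat_le// (_ : Num.min _ _ = 2 * ival s)//.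
    by rewrite /Num.min; case: ifP => ?; lra.
  rewrite concat_gt//= /rev_fun clampK; last lra.
  congr (v (clamp _)).
  by rewrite /Num.min; case: ifP => ?; lra.
- by move=> s; rewrite loop0.
Qed.

Lemma concat_rev_l v : homotopic (concat (rev_loop v) v) cst_loop.
Proof.
apply: (@homotopic_reparam v _ _
  (fun r => Num.max (- 2 * r + 1) (2 * r + -1)) (cst 1)).
- by move=> r; apply: (@continuous_max R R (fun r => - 2 * r + 1)
    (fun r => 2 * r + -1)); exact: continuous_affine.
- by move=> r; exact: cvg_cst.
- by rewrite /= /Num.max; case: ifP => ?; lra.
- by rewrite /= /Num.max; case: ifP => ?; lra.
- move=> s; have /andP[s0 s1] := ival_itv s.
  have [s2|s2] := leP (ival s) 2^-1.
    rewrite concat_le//= /rev_fun clampK; last lra.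
    congr (v (clamp _)).
    by rewrite /Num.max; case: ifP => ?; lra.
  rewrite concat_gt// (_ : Num.max _ _ = 2 * ival s - 1)//.
  by rewrite /Num.max; case: ifP => ?; lra.
- by move=> s; rewrite loop1.
Qed.

HB.instance Definition _ := gen_eqMixin loop.
HB.instance Definition _ := gen_choiceMixin loop.

Definition homotopicb : rel loop := fun v w => `[< homotopic v w >].

Lemma homotopicb_refl : reflexive homotopicb.
Proof. by move=> v; apply/asboolP; exact: homotopic_refl. Qed.

Lemma homotopicb_sym : symmetric homotopicb.
Proof. by move=> v w; apply/asboolP/asboolP; exact: homotopic_sym. Qed.

Lemma homotopicb_trans : transitive homotopicb.
Proof.
by move=> v u w /asboolP uv /asboolP vw; apply/asboolP/(homotopic_trans uv vw).
Qed.

Canonical homotopic_equiv :=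
  EquivRel homotopicb homotopicb_refl homotopicb_sym homotopicb_trans.

Definition pi1 := {eq_quot homotopicb}.

HB.instance Definition _ := Choice.on pi1.

Definition loop_class (v : loop) : pi1 := \pi_pi1 v.

Lemma pi1P v w : loop_class v = loop_class w <-> homotopic v w.
Proof. by split=> [/eqmodP/asboolP|/asboolP vw]//; exact/eqmodP. Qed.

Lemma pi1W (P : pi1 -> Prop) : (forall v, P (loop_class v)) -> forall a, P a.
Proof. by move=> Pv a; rewrite -[a]reprK; exact: Pv. Qed.

Definition pi1_one : pi1 := loop_class cst_loop.
Definition pi1_mul (a b : pi1) : pi1 := loop_class (concat (repr a) (repr b)).
Definition pi1_inv (a : pi1) : pi1 := loop_class (rev_loop (repr a)).

Lemma pi1_repr v : homotopic (repr (loop_class v)) v.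
Proof. by apply/pi1P; exact: reprK. Qed.

Lemma pi1_mulE v w :
  pi1_mul (loop_class v) (loop_class w) = loop_class (concat v w).
Proof. by apply/pi1P; apply: homotopic_concat; exact: pi1_repr. Qed.

Lemma pi1_invE v : pi1_inv (loop_class v) = loop_class (rev_loop v).
Proof. by apply/pi1P; apply: homotopic_rev; exact: pi1_repr. Qed.

Lemma pi1_mulA : associative pi1_mul.
Proof.
elim/pi1W=> u; elim/pi1W=> v; elim/pi1W=> w.
rewrite (pi1_mulE v w) (pi1_mulE u v) (pi1_mulE u) (pi1_mulE _ w).
exact/pi1P/concat_assoc.
Qed.

Lemma pi1_mul1g : left_id pi1_one pi1_mul.
Proof.
by elim/pi1W=> v; rewrite (pi1_mulE cst_loop v); exact/pi1P/concat_cst_l.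
Qed.

Lemma pi1_mulg1 : right_id pi1_one pi1_mul.
Proof.
by elim/pi1W=> v; rewrite (pi1_mulE v cst_loop); exact/pi1P/concat_cst_r.
Qed.

Lemma pi1_mulVg : left_inverse pi1_one pi1_inv pi1_mul.
Proof.
elim/pi1W=> v; rewrite (pi1_invE v) (pi1_mulE _ v).
exact/pi1P/concat_rev_l.
Qed.

Lemma pi1_mulgV : right_inverse pi1_one pi1_inv pi1_mul.
Proof.
elim/pi1W=> v; rewrite (pi1_invE v) (pi1_mulE v).
exact/pi1P/concat_rev_r.
Qed.

HB.instance Definition _ :=
  isGroup.Build pi1 pi1_mulA pi1_mul1g pi1_mulg1 pi1_mulVg pi1_mulgV.

End FundamentalGroup.

Section CyclicClosure.
Variables n m : nat.

(* 'I_n represents the integers modulo n when 0 < n; 'Z_n is avoided because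
   'Z_1 has two elements. *)
Definition cyc_ball (k : 'I_n) : set 'I_n :=
  [set j | exists2 i : int, `|i| <= m%:Z & (j%:Z = k%:Z + i %[mod n%:Z])%Z].

Definition cyc_cl (A : set 'I_n) : set 'I_n := \bigcup_(k in A) cyc_ball k.

Lemma cyc_cl0 : cyc_cl set0 = set0.
Proof. exact: bigcup_set0. Qed.

Lemma sub_cyc_cl A : A `<=` cyc_cl A.
Proof. by move=> k Ak; exists k => //; exists 0; rewrite ?normr0 ?addr0. Qed.

Lemma cyc_clU A B : cyc_cl (A `|` B) = cyc_cl A `|` cyc_cl B.
Proof. exact: bigcup_setU. Qed.

Definition Zcl : closureSpace := ClosureSpace cyc_cl0 sub_cyc_cl cyc_clU.

End CyclicClosure.

(* Main.v *)
Require Import Defs.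
From mathcomp Require Import all_boot all_order all_algebra.
From mathcomp Require Import all_classical all_reals all_analysis.
From mathcomp Require Import zify.
Local Open Scope classical_set_scope.

(** Going around the circle of [n] points in the shorter direction, any two
    points are at most [n %/ 2] steps apart.  Since [3 %/ 2 = 1], both
    hypotheses on [m] thus say that a single closure step already reaches the
    whole of [Zcl n m] from any point ([cyc_ball_half]): the space is
    indiscrete ([Zcl_indiscrete]).  Every map into an indiscrete space is
    continuous ([ccontinuous_indiscrete]), so a loop can be contracted in one
    jump, by a map that is the loop at time 0 and the basepoint at every later
    time ([homotopic_indiscrete]). *)

Definition indiscrete (X : closureSpace) :=
  forall A : set X, A !=set0 -> cl A = setT.

Lemma ccontinuous_indiscrete (Y X : closureSpace) (f : Y -> X) :
  indiscrete X -> ccontinuous f.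
Proof.
move=> indX A _ [y Ay <-].
have [[a Aa]|/set0P/negP/negPn/eqP A0] := pselect (A !=set0).
  by rewrite indX //; exists (f a), a.
by move: Ay; rewrite A0 cl0.
Qed.

(** The homotopy jumps from [v] to [w] immediately after time 0; the jump is
    continuous because every map into [X] is. *)
Lemma homotopic_indiscrete (R : realType) (X : closureSpace) (x : X)
  (v w : loop R x) : indiscrete X -> homotopic v w.
Proof.
move=> indX.
exists (fun p => if ival p.2 == 0%R then v p.1 else w p.1); split.
- exact: ccontinuous_indiscrete.
- by move=> s; rewrite /= ival0 eqxx.
- by move=> s; rewrite /= ival1 GRing.oner_eq0.
- by move=> t /=; rewrite !loop0 !loop1; case: ifP.
Qed.

Lemma pi1_indiscrete (R : realType) (X : closureSpace) (x : X) :
  indiscrete X -> [set: pi1 R x] = [set 1%g].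
Proof.
move=> indX; apply/seteqP; split=> // a _.
by elim/pi1W: a => v; apply/pi1P/homotopic_indiscrete.
Qed.

(** The step from [k] to [j] is [j - k], corrected by a full turn in either
    direction when it is longer than half the circle. *)
Lemma cyc_ball_half (n m : nat) (k j : 'I_n) :
  (n %/ 2 <= m)%N -> cyc_ball m k j.
Proof.
move=> hm; have kn := ltn_ord k; have jn := ltn_ord j.
have [far|near] := ltnP (k + n %/ 2) j.
  exists (j%:Z - k%:Z - n%:Z)%R; first by lia.
  by rewrite -[RHS]intdiv.modzDr GRing.addrA GRing.subrKC GRing.subrK.
have [far'|near'] := ltnP (j + n %/ 2) k.
  exists (j%:Z - k%:Z + n%:Z)%R; first by lia.
  by rewrite GRing.addrA GRing.subrKC intdiv.modzDr.
by exists (j%:Z - k%:Z)%R; [lia | rewrite GRing.subrKC].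
Qed.

Lemma Zcl_indiscrete (n m : nat) : (n %/ 2 <= m)%N -> indiscrete (Zcl n m).
Proof.
move=> hm A [k Ak]; apply/seteqP; split=> // j _.
by exists k => //; exact: cyc_ball_half.
Qed.

Theorem theorem4p53 (R : realType) (n m : nat) (hn : (1 <= n)%N)
    (hm : (n %/ 2 <= m)%N \/ (n = 3%N /\ (1 <= m)%N)) (x : Zcl n m) :
  [set: pi1 R x] = [set 1%g].
Proof.
have half : (n %/ 2 <= m)%N by case: hm => // -[-> m1].
exact/pi1_indiscrete/Zcl_indiscrete.
Qed.
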